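(* For any base $b\ge2$, $$K(3)=\begin{cases}129,& b=2,\\ 28,& b=3,\\ b^{b+3}+1,& b\ge4 \text{ even},\\ b^2+1,& b\ge5\text{ odd},\end{cases}\qquad B(3)=\begin{cases}7,& b=2,\\ 3,& b=3,\\ b+3,& b\ge4\text{ even},\\ 2,& b\ge5\text{ odd},\end{cases}$$ where $B(3)=\lfloor\log_b K(3)\rfloor$.
   Context: Fix a base $b\ge2$. For $v\in\mathbb{N}$, $s(v)$ is the sum of the base-$b$ digits of $v$, $f(v)=v+s(v)$, and $F(u)=|\{v\in\mathbb{N}: f(v)=u\}|$. For $n\ge1$, $K(n)$ denotes the smallest $u\in\mathbb{N}$ with $F(u)=n$. *)

(* Defs.v *)
From mathcomp Require Import all_boot finmap.
From mathcomp Require Import boolp classical_sets cardinality.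
Set Implicit Arguments.
Unset Strict Implicit.
Unset Printing Implicit Defensive.

(* The i-th base-b digit of v is (v %/ b ^ i) %% b; for 1 < b the digits of
   index i >= v vanish because v < b ^ v. *)
Definition digit_sum (b v : nat) : nat := \sum_(i < v) (v %/ b ^ i) %% b.

Definition digit_add (b v : nat) : nat := v + digit_sum b v.

(* The set is finite since v <= digit_add b v, so fset_set is not defaulting. *)
Definition generators_count (b u : nat) : nat :=
  #|` fset_set [set v : nat | digit_add b v = u]%classic |%fset.

(* The default value 0 is only taken when no u has exactly n generators; as
   generators_count b 0 = 1, it is a genuine value of K only for n = 1. *)
Definition K (b n : nat) : nat :=
  if pselect (exists u : nat, generators_count b u == n) is left exu
  then ex_minn exu else 0.

(* trunc_log b m is the largest e with b ^ e <= m, i.e. the floor of log_b m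
   (for 1 < b and 0 < m). *)
Definition B (b n : nat) : nat := trunc_log b (K b n).

(* Main.v *)
(* Write f(v) = v + s(v), so that f(b^k) = b^k + 1.  In each case K(3) = b^k + 1:
   no value of f is taken three times below b^k, hence F(u) <= 2 for u <= b^k,
   while b^k + 1 is taken twice below b^k and a third time at b^k itself.

   If v = c b^k + r and v' = c' b^k + r' collide with top digits c < c', then
   c' = c + 1 and f(b^k - 1 - r) + f(r') = k(b-1) - 2.  For odd b > 4 this forbids
   triples below b^2.  For even b > 3, a triple with different top digits yields a
   collision p <> q with f(p) = f(q) and f(p) + f(z) = k(b-1) - 2.  Collisions with
   f(p) < b^2 + b have f(p) odd and larger than b^2, so such a
   triple has its first differing digit at a position k >= b + 3.  The bases 2 and 3 are settled by computation. *)
Require Import Defs.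
From mathcomp Require Import all_boot finmap zify.
From mathcomp Require Import boolp classical_sets cardinality.

(** * Digit sums and collisions in a general base *)

Section Digits.
Variables (b : nat) (hb : 2 <= b).

(** Digits of index at least [m] vanish when [v < b ^ m], so both ranges extend to [v + n]. *)
Lemma digit_sum_widen {v n} : v < b ^ n ->
  digit_sum b v = \sum_(i < n) (v %/ b ^ i) %% b.
Proof.
have widen m : m <= v + n -> v < b ^ m ->
    \sum_(i < m) (v %/ b ^ i) %% b = \sum_(i < v + n) (v %/ b ^ i) %% b.
  move=> lem ltv; rewrite -!(big_mkord xpredT (fun i => (v %/ b ^ i) %% b)).
  rewrite [RHS](big_cat_nat (n := m)) //=.
  rewrite [X in _ + X]big_nat_cond [X in _ + X]big1 ?addn0 //.
  move=> i /andP[/andP[lemi _] _].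
  by rewrite divn_small ?mod0n // (leq_trans ltv) // leq_exp2l.
move=> ltv; have ltvv : v < b ^ v by apply: ltn_expl.
by rewrite /digit_sum (widen v) ?leq_addr // (widen n) ?leq_addl.
Qed.

Lemma digit_sum_small {d} : d < b -> digit_sum b d = d.
Proof.
by move=> ltd; rewrite (digit_sum_widen (n := 1)) // big_ord1 divn1 modn_small.
Qed.

Lemma digit_sum_cons q r : r < b -> digit_sum b (q * b + r) = digit_sum b q + r.
Proof.
move=> ltr; have ltq : q < b ^ q by apply: ltn_expl.
rewrite (digit_sum_widen (n := q.+1)); last first.
  rewrite expnSr; apply: (@leq_trans (q.+1 * b)); first by rewrite mulSn; lia.
  by rewrite leq_mul2r ltq orbT.
rewrite (digit_sum_widen ltq) big_ord_recl divn1 modnMDl modn_small // addnC.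
congr (_ + _); apply: eq_bigr => i _.
by rewrite /= /bump add1n expnS divnMA divnMDl ?(divn_small ltr) ?addn0 //; lia.
Qed.

Lemma digit_sum_cat k c r : r < b ^ k ->
  digit_sum b (c * b ^ k + r) = digit_sum b c + digit_sum b r.
Proof.
elim: k r => [|k IHk] r ltr.
  by move: ltr; case: r => // _; rewrite muln1 addn0 [digit_sum b 0]big_ord0 addn0.
have ltrb : r %/ b < b ^ k by rewrite ltn_divLR -?expnSr //; lia.
have ltm : r %% b < b by rewrite ltn_mod; lia.
rewrite (_ : c * _ + r = (c * b ^ k + r %/ b) * b + r %% b); last first.
  by rewrite mulnDl -addnA -divn_eq expnSr mulnA.
rewrite digit_sum_cons // IHk // -addnA; congr (_ + _).
by rewrite -digit_sum_cons // -divn_eq.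
Qed.

(** Passing from r to b^k - 1 - r replaces each of the k digits d by b - 1 - d. *)
Lemma digit_sum_compl {k r} : r < b ^ k ->
  digit_sum b (b ^ k - r.+1) + digit_sum b r = k * (b - 1).
Proof.
elim: k r => [|k IHk] r ltr; first by case: r ltr => //= _; rewrite /digit_sum !big_ord0.
have ltrb : r %/ b < b ^ k by rewrite ltn_divLR -?expnSr //; lia.
have ltm : r %% b < b by rewrite ltn_mod; lia.
have {1}-> : b ^ k.+1 - r.+1 = (b ^ k - (r %/ b).+1) * b + (b - (r %% b).+1).
  by have := divn_eq r b; rewrite expnSr; nia.
rewrite {3}(divn_eq r b) !digit_sum_cons //; last by lia.
by have := IHk _ ltrb; lia.
Qed.

Lemma leq_digit_add v : v <= digit_add b v.
Proof. exact: leq_addr. Qed.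

Lemma digit_add_small {d} : d < b -> digit_add b d = d.*2.
Proof. by move=> ltd; rewrite /digit_add digit_sum_small // addnn. Qed.

Lemma digit_add_cat k c r : c < b -> r < b ^ k ->
  digit_add b (c * b ^ k + r) = c * (b ^ k).+1 + digit_add b r.
Proof. by move=> ltc ltr; rewrite /digit_add digit_sum_cat // digit_sum_small //; lia. Qed.

Lemma digit_add_compl {k r} : r < b ^ k ->
  digit_add b (b ^ k - r.+1) + digit_add b r + 1 = b ^ k + k * (b - 1).
Proof. by move=> ltr; have := digit_sum_compl ltr; rewrite /digit_add; lia. Qed.

Lemma digit_add_expn k : digit_add b (b ^ k) = (b ^ k).+1.
Proof.
have := digit_add_cat k 1 0; rewrite mul1n addn0 => -> //; last by rewrite expn_gt0; lia.
by rewrite [digit_add b 0](_ : _ = 0) /digit_add /digit_sum ?big_ord0 //; lia.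
Qed.

(** Equality reads f(r) = (c' - c)(b^k + 1) + f(r'). Since f(r) < b^k + k(b-1) < 2 b^k, the
    difference c' - c is 1; expressing f(r) through the complement of r gives the second
    equation. *)
Lemma collision_top k c c' r r' :
    c < c' -> c' < b -> r < b ^ k -> r' < b ^ k ->
    digit_add b (c * b ^ k + r) = digit_add b (c' * b ^ k + r') ->
  c' = c.+1 /\ digit_add b (b ^ k - r.+1) + digit_add b r' + 2 = k * (b - 1).
Proof.
move=> ltcc' ltc' ltr ltr'; rewrite !digit_add_cat //; last by lia.
have bernoulli : k * (b - 1) < b ^ k.
  by elim: (k) => // m IHm; rewrite expnS; nia.
have compl := digit_add_compl ltr; have [d ->] : exists d, c' = c.+1 + d.
  by exists (c' - c.+1); lia.
by case: d => [|d]; rewrite !mulnDl ?mulSn; nia.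
Qed.

Lemma ltn_digits k v : v < b ^ k.+1 ->
  [/\ v = (v %/ b ^ k) * b ^ k + v %% b ^ k, v %/ b ^ k < b & v %% b ^ k < b ^ k].
Proof.
have bk_gt0 : 0 < b ^ k by rewrite expn_gt0; lia.
by move=> ltv; rewrite -divn_eq ltn_mod ltn_divLR // -expnS.
Qed.

Lemma collision_adjacent k x y : x < b ^ k.+1 -> y < b ^ k.+1 ->
  digit_add b x = digit_add b y -> y %/ b ^ k <= (x %/ b ^ k).+1.
Proof.
move=> /ltn_digits[xE ltcx ltrx] /ltn_digits[yE ltcy ltry].
have [//|ltc] := leqP (y %/ b ^ k) (x %/ b ^ k).+1.
rewrite {1}xE {1}yE => /(collision_top _ _ _ _ _ (ltnW ltc) ltcy ltrx ltry)[cE].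
by rewrite cE ltnn in ltc.
Qed.

(* The three leading digits are pairwise within 1 of each other. *)
Lemma triple_top k x y z : x < b ^ k.+1 -> y < b ^ k.+1 -> z < b ^ k.+1 ->
    digit_add b x = digit_add b y -> digit_add b x = digit_add b z ->
  [|| x %/ b ^ k == y %/ b ^ k, x %/ b ^ k == z %/ b ^ k
    | y %/ b ^ k == z %/ b ^ k].
Proof.
move=> ltx lty ltz fxy fxz.
have fyz : digit_add b y = digit_add b z by rewrite -fxy.
have := collision_adjacent _ _ _ ltx lty fxy.
have := collision_adjacent _ _ _ lty ltx (esym fxy).
have := collision_adjacent _ _ _ ltx ltz fxz.
have := collision_adjacent _ _ _ ltz ltx (esym fxz).
have := collision_adjacent _ _ _ lty ltz fyz.
have := collision_adjacent _ _ _ ltz lty (esym fyz).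
by move: (x %/ _) (y %/ _) (z %/ _); clear; lia.
Qed.

Lemma digit_add_top_inj k x y : x < b ^ k.+1 -> y < b ^ k.+1 ->
    x %/ b ^ k = y %/ b ^ k -> digit_add b x = digit_add b y ->
  digit_add b (x %% b ^ k) = digit_add b (y %% b ^ k).
Proof.
move=> /ltn_digits[xE ltcx ltrx] /ltn_digits[yE ltcy ltry] eqc.
by rewrite {1}xE {1}yE -eqc !digit_add_cat // => /addnI.
Qed.

End Digits.

(** * Reduction to the absence of triples below a power of the base *)

Definition triple_free b m := forall x y z, x < m -> y < m -> z < m ->
  digit_add b x = digit_add b y -> digit_add b x = digit_add b z ->
  [|| x == y, x == z | y == z].

(** As v <= f(v), every preimage of u occurs in the list 0, ..., u. *)
Lemma generators_countE b u :
  generators_count b u = size [seq v <- iota 0 u.+1 | digit_add b v == u].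
Proof.
set s := [seq v <- _ | _].
have uniq_s : uniq s by rewrite filter_uniq ?iota_uniq.
have -> : generators_count b u = #|` [fset v in s]%fset |%fset.
  rewrite /generators_count; congr (#|` _|%fset).
  rewrite -[RHS]set_fsetK; congr fset_set; apply/seteqP; split => v /=.
    rewrite !inE mem_filter mem_iota => <-; rewrite eqxx /=.
    by have := leq_addr (digit_sum b v) v; rewrite /digit_add; lia.
  by rewrite !inE mem_filter => /andP[/eqP].
by rewrite card_fseq undup_id.
Qed.

Lemma K_eq b n u : generators_count b u = n ->
  (forall w, w < u -> generators_count b w != n) -> K b n = u.
Proof.
move=> cu min_u; rewrite /K; case: pselect => [exu|[]]; last first.
  by exists u; apply/eqP.
case: ex_minnP => m cm min_m; apply/eqP; rewrite eqn_leq min_m ?cu //=.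
by rewrite leqNgt; apply/negP => /min_u /negP[].
Qed.

Lemma first_triple b k x y : 2 <= b -> 0 < k -> triple_free b (b ^ k) ->
    x < b ^ k -> y < b ^ k -> x != y ->
    digit_add b x = b ^ k + 1 -> digit_add b y = b ^ k + 1 ->
  K b 3 = b ^ k + 1 /\ B b 3 = k.
Proof.
move=> hb k_gt0 free ltx lty nexy fx fy.
have gen3 u : u <= b ^ k -> generators_count b u != 3.
  move=> leu; rewrite generators_countE; apply/eqP.
  set s := [seq _ <- _ | _] => size_s.
  have uniq_s : uniq s by rewrite filter_uniq ?iota_uniq.
  have s_lt v : v \in s -> v < b ^ k /\ digit_add b v = u.
    rewrite mem_filter => /andP[/eqP fv _]; split => //.
    have := leq_digit_add b v; rewrite fv => levu.
    (* From v <= u <= b^k only v = b^k remains to be excluded, and f(b^k) exceeds u. *)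
    have : v != b ^ k; last by lia.
    by apply/eqP => vk; move: fv; rewrite vk digit_add_expn //; lia.
  move: s size_s uniq_s s_lt => [|p [|q [|r []]]] //= _ uniq_s s_lt.
  have [|ltp fp] := s_lt p; rewrite ?inE ?eqxx //.
  have [|ltq fq] := s_lt q; rewrite ?inE ?eqxx ?orbT //.
  have [|ltr fr] := s_lt r; rewrite ?inE ?eqxx ?orbT //.
  have := free p q r ltp ltq ltr; rewrite fp fq fr => /(_ erefl erefl).
  by move: uniq_s; rewrite !inE; lia.
have Keq : K b 3 = b ^ k + 1.
  apply: K_eq => [|w]; last by rewrite addn1 ltnS; apply: gen3.
  rewrite generators_countE; set s := [seq _ <- _ | _].
  have uniq_s : uniq s by rewrite filter_uniq ?iota_uniq.
  have : perm_eq s [:: x; y; b ^ k]; last by move/perm_size.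
  apply: uniq_perm => //=; first by rewrite !inE; lia.
  move=> v; rewrite mem_filter mem_iota !inE add0n /=; apply/idP/idP; last first.
    case/or3P => /eqP ->; rewrite ?fx ?fy ?digit_add_expn //; lia.
  case/andP=> /eqP fv ltv.
  have [ltvk|] := ltnP v (b ^ k).
    have := free v x y ltvk ltx lty; rewrite fv fx fy => /(_ erefl erefl); lia.
  rewrite leq_eqVlt => /orP[/eqP->|ltkv]; first by rewrite eqxx !orbT.
  (* The last candidate fails: f(b^k + 1) = b^k + 3. *)
  have vE : v = (b ^ k).+1 by lia.
  have lt1 : 1 < b ^ k by rewrite -{1}(expn0 b) ltn_exp2l.
  move: fv; rewrite vE -addn1 -{1}[b ^ k]mul1n digit_add_cat // digit_add_small //; lia.
split=> //; rewrite /B Keq; apply: trunc_log_eq => //.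
rewrite leq_addr /= expnS.
have lt1 : 1 < b ^ k by rewrite -{1}(expn0 b) ltn_exp2l.
nia.
Qed.

(** * Even bases from 4 on *)

Section EvenBase.
Variables (b : nat) (b_gt3 : 3 < b) (b_even : ~~ odd b).

Let hb : 2 <= b := ltn_trans (isT : 1 < 3) b_gt3.

(** Different leading digits would give 2(b - 1 - r) + 2r' + 2 = b - 1, which is odd; under a common
    leading digit, the last digits have equal doubles. *)
Lemma digit_add_inj_lt_sqr x y : x < y -> y < b ^ 2 ->
  digit_add b x != digit_add b y.
Proof.
move=> ltxy lty; apply/eqP.
have [xE ltcx ltrx] := ltn_digits _ hb 1 x (ltn_trans ltxy lty).
have [yE ltcy ltry] := ltn_digits _ hb 1 y lty.
have lecc : x %/ b ^ 1 <= y %/ b ^ 1 by rewrite leq_div2r // ltnW.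
rewrite {1}xE {1}yE; have [ltcc|] := ltnP (x %/ b ^ 1) (y %/ b ^ 1).
  case/(collision_top _ hb) => // _; rewrite !digit_add_small //; lia.
move=> gecc; have eqc : x %/ b ^ 1 = y %/ b ^ 1 by lia.
rewrite -eqc !digit_add_cat // !digit_add_small //; lia.
Qed.

(** Injectivity below b^2 forces y = b^2 + d, and y <= f(y) gives d < b; hence f(y) = b^2 + 1 +
    2d. *)
Lemma collision_below x y : x < y -> digit_add b x = digit_add b y ->
  digit_add b x < b ^ 2 + b -> b ^ 2 < digit_add b x /\ odd (digit_add b x).
Proof.
move=> ltxy fxy; rewrite fxy => ltf.
have gey : b ^ 2 <= y.
  rewrite leqNgt; apply/negP => lty.
  by have := digit_add_inj_lt_sqr x y ltxy lty; rewrite fxy eqxx.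
have ley := leq_digit_add b y.
have ltd : y - b ^ 2 < b by lia.
have ltb : b < b ^ 2 by rewrite ltn_Pmull //; lia.
have -> : digit_add b y = (b ^ 2).+1 + (y - b ^ 2).*2.
  rewrite -(digit_add_small _ hb ltd) -[in RHS](mul1n (b ^ 2).+1).
  by rewrite -digit_add_cat ?(ltn_trans ltd) //; congr digit_add; lia.
by split; [lia | rewrite oddD /= odd_double oddX (negbTE b_even)].
Qed.

(* Here [z] is a single digit, so [k * (b - 1)] is odd, hence [k] is odd and at
   most [b + 1]; then [k * (b - 1) <= b ^ 2 - 1] is too small. *)
Lemma compl_collision k p q z : k <= b.+2 -> p != q ->
  digit_add b p = digit_add b q -> digit_add b p + digit_add b z + 2 <> k * (b - 1).
Proof.
wlog ltpq : p q / p < q.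
  move=> wl lek nepq fpq; have [ltpq|ltqp|] := ltngtP p q; last by lia.
    exact: wl ltpq lek nepq fpq.
  by rewrite fpq; apply: wl ltqp lek _ _; rewrite // eq_sym.
move=> lek _ fpq fz.
(* For k <= b + 2 the right side is at most b^2 + b - 2; once f(p) > b^2 is known, less than b is
   left for f(z). *)
have ltf : digit_add b p < b ^ 2 + b by nia.
have [gtf oddf] := collision_below p q ltpq fpq ltf.
have lez := leq_digit_add b z.
have ltz : z < b by nia.
move: fz; rewrite (digit_add_small _ hb ltz) => fz.
have oddk : odd k by move: (congr1 odd fz); rewrite oddM; lia.
have : k <= b.+1 by lia.
by nia.
Qed.

(** Induction on the number of digits: a leading digit common to all three is removed; otherwise
    exactly two leading digits agree, and [step] identifies those two numbers. *)
Lemma triple_free_even k : k <= b + 3 -> triple_free b (b ^ k).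
Proof.
elim: k => [_ x y z|k IHk lek x y z ltx lty ltz fxy fxz]; first by lia.
have step u v w : u < b ^ k.+1 -> v < b ^ k.+1 -> w < b ^ k.+1 ->
    digit_add b u = digit_add b v -> digit_add b u = digit_add b w ->
    u %/ b ^ k = v %/ b ^ k -> u %/ b ^ k != w %/ b ^ k -> u == v.
  move=> /(ltn_digits _ hb)[uE ltcu ltru] /(ltn_digits _ hb)[vE ltcv ltrv].
  move=> /(ltn_digits _ hb)[wE ltcw ltrw] fuv fuw eqc neqc.
  apply/eqP; rewrite uE vE -eqc; congr (_ + _); apply/eqP; apply/negPn/negP => ner.
  have lek2 : k <= b.+2 by lia.
  have fr : digit_add b (u %% b ^ k) = digit_add b (v %% b ^ k).
    by move: fuv; rewrite {1}uE {1}vE -eqc !digit_add_cat // => /addnI.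
  rewrite uE wE in fuw.
  (* If w has the larger leading digit, the complements of the lower parts of u and v form the
     colliding pair; if it has the smaller one, the lower parts themselves do. *)
  move: neqc; rewrite neq_ltn => /orP[] ltc.
    have [_ eu] := collision_top _ hb _ _ _ _ _ ltc ltcw ltru ltrw fuw.
    have complu := digit_add_compl _ hb ltru; have complv := digit_add_compl _ hb ltrv.
    by apply: (compl_collision k _ (b ^ k - (v %% b ^ k).+1) _ lek2 _ _ eu); lia.
  have [_ eu] := collision_top _ hb _ _ _ _ _ ltc ltcu ltrw ltru (esym fuw).
  apply: (compl_collision k _ _ (b ^ k - (w %% b ^ k).+1) lek2 ner fr).
  by rewrite -eu; lia.
have [cxy|ncxy] := eqVneq (x %/ b ^ k) (y %/ b ^ k).
  have [cxz|ncxz] := eqVneq (x %/ b ^ k) (z %/ b ^ k); last first.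
    by rewrite (step x y z).
  have [xE ltcx ltrx] := ltn_digits _ hb _ _ ltx.
  have [yE ltcy ltry] := ltn_digits _ hb _ _ lty.
  have [zE ltcz ltrz] := ltn_digits _ hb _ _ ltz.
  rewrite xE yE zE -cxy -cxz !eqn_add2l; apply: IHk => //; first by lia.
    by apply: digit_add_top_inj.
  by apply: digit_add_top_inj.
have [cxz|ncxz] := eqVneq (x %/ b ^ k) (z %/ b ^ k).
  by rewrite (step x z y) ?orbT.
have [cyz|ncyz] := eqVneq (y %/ b ^ k) (z %/ b ^ k).
  by rewrite (step y z x) ?orbT // -?fxy //; rewrite eq_sym.
by have := triple_top _ hb _ _ _ _ ltx lty ltz fxy fxz;
  rewrite (negbTE ncxy) (negbTE ncxz) (negbTE ncyz).
Qed.

Lemma K_even : K b 3 = b ^ (b + 3) + 1 /\ B b 3 = b + 3.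
Proof.
have lt_sqr : b < b ^ 2 by rewrite ltn_Pmull //; lia.
have sqrE : b ^ 2 = b * b by [].
have lt_pow : b ^ 2 + b < b ^ (b + 3).
  apply: (@leq_trans (b ^ 3)); first by rewrite expnS; nia.
  by rewrite leq_exp2l // leq_addl.
(* Both have f = b^2 + 2b - 5 = k(b-1) - 2 for k = b + 3, so their complements in b^k - 1 have f =
   b^k + 1. *)
pose p := 1 * b ^ 2 + (b - 3); pose q := (b - 1) * b ^ 1 + (b - 2).
have ltp : p < b ^ (b + 3) by rewrite /p; lia.
have ltq : q < b ^ (b + 3) by rewrite /q; nia.
have fp : digit_add b p + 2 = (b + 3) * (b - 1).
  by rewrite /p digit_add_cat ?digit_add_small //; nia.
have fq : digit_add b q + 2 = (b + 3) * (b - 1).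
  by rewrite /q digit_add_cat ?digit_add_small //; nia.
have complp := digit_add_compl _ hb ltp; have complq := digit_add_compl _ hb ltq.
apply: (@first_triple b _ (b ^ (b + 3) - p.+1) (b ^ (b + 3) - q.+1)) => //.
- by lia.
- exact: triple_free_even.
- by lia.
- by lia.
- suff : p != q by lia.
  by rewrite /p /q; nia.
- by lia.
- by lia.
Qed.

End EvenBase.

(** * Two-digit numbers and odd bases from 5 on *)

(** Two of the three numbers share their leading digit, and then their last digits have equal
    doubles. *)
Lemma triple_free_sqr b : 2 <= b -> triple_free b (b ^ 2).
Proof.
move=> hb x y z ltx lty ltz fxy fxz.
have inj u v : u < b ^ 2 -> v < b ^ 2 -> digit_add b u = digit_add b v ->
    u %/ b ^ 1 = v %/ b ^ 1 -> u = v.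
  move=> ltu ltv fuv eqc; have := digit_add_top_inj _ hb 1 u v ltu ltv eqc fuv.
  have modb w : w %% b ^ 1 < b by rewrite expn1 ltn_mod; lia.
  rewrite !digit_add_small // => /double_inj eqr.
  by rewrite (divn_eq u (b ^ 1)) (divn_eq v (b ^ 1)) eqc eqr.
have fyz : digit_add b y = digit_add b z by rewrite -fxy.
have /or3P[] := triple_top _ hb _ _ _ _ ltx lty ltz fxy fxz => /eqP eqc.
- by rewrite (inj x y) ?eqxx.
- by rewrite (inj x z) ?eqxx ?orbT.
- by rewrite (inj y z) ?eqxx ?orbT.
Qed.

Lemma K_odd b : 4 < b -> odd b -> K b 3 = b ^ 2 + 1 /\ B b 3 = 2.
Proof.
move=> b_gt4 b_odd; have hb : 2 <= b by lia.
have sqrE : b ^ 2 = b * b by [].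
have ltr : (b + 3)./2 < b by lia.
have dblr : (b + 3)./2.*2 = b + 3 by rewrite even_halfK // oddD b_odd.
(* Solutions of c(b + 1) + 2d = b^2 + 1: c = b - 1 gives d = 1, and c = b - 2 gives 2d = b + 3,
   which is even. *)
apply: (@first_triple b 2 ((b - 1) * b ^ 1 + 1) ((b - 2) * b ^ 1 + (b + 3)./2)).
- by [].
- by [].
- exact: triple_free_sqr.
- by nia.
- by nia.
- by nia.
- by rewrite digit_add_cat ?digit_add_small //; nia.
- by rewrite digit_add_cat ?digit_add_small ?dblr //; nia.
Qed.

(** * Bases 2 and 3 by computation *)

(** A list of fixed length, so that its sum reduces under [vm_compute]. *)
Definition digits b k v := [seq (v %/ b ^ i) %% b | i <- iota 0 k].

Lemma digit_addE b k v : 2 <= b -> v < b ^ k ->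
  digit_add b v = v + sumn (digits b k v).
Proof.
move=> hb ltv; rewrite /digit_add (digit_sum_widen _ hb ltv) sumnE big_map.
by rewrite -(big_mkord xpredT (fun i => (v %/ b ^ i) %% b)) /index_iota subn0.
Qed.

(** Three distinct arguments with one value would give that value multiplicity at least 3 in the
    list. *)
Lemma triple_free_count b k : 2 <= b ->
    (let s := [seq v + sumn (digits b k v) | v <- iota 0 (b ^ k)] in
     all (fun u => count_mem u s < 3) s) ->
  triple_free b (b ^ k).
Proof.
move=> hb /allP /= count3 x y z ltx lty ltz.
rewrite !(digit_addE _ k) // => fxy fxz; apply/negPn/negP => distinct.
have /count3 : x + sumn (digits b k x) \in
    [seq v + sumn (digits b k v) | v <- iota 0 (b ^ k)].
  by apply: map_f; rewrite mem_iota.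
rewrite count_map ltnNge -size_filter => /negP; apply.
apply: (@uniq_leq_size _ [:: x; y; z]); first by rewrite /= !inE; lia.
by move=> v; rewrite !inE mem_filter mem_iota => /or3P[] /eqP->;
  rewrite /= -?fxy -?fxz eqxx.
Qed.

Theorem theorem4p3 (b : nat) (hb : 2 <= b) :
  K b 3 = (if b == 2 then 129
           else if b == 3 then 28
           else if ~~ odd b then b ^ (b + 3) + 1
           else b ^ 2 + 1)
  /\
  B b 3 = (if b == 2 then 7
           else if b == 3 then 3
           else if ~~ odd b then b + 3
           else 2).
Proof.
have [->|b_neq2] := eqVneq b 2.
  (* In binary, 123 = 1111011 and 124 = 1111100, both with f = 129 = 2^7 + 1. *)
  apply: (@first_triple 2 7 123 124) => //; last 2 first.
  - by rewrite (digit_addE _ 7).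
  - by rewrite (digit_addE _ 7).
  by apply: (@triple_free_count 2 7); last vm_compute.
have [->|b_neq3] := eqVneq b 3.
  (* In base 3, 23 = 212 and 24 = 220, both with f = 28 = 3^3 + 1. *)
  apply: (@first_triple 3 3 23 24) => //; last 2 first.
  - by rewrite (digit_addE _ 3).
  - by rewrite (digit_addE _ 3).
  by apply: (@triple_free_count 3 3); last vm_compute.
have [b_even|/negPn b_odd] := boolP (~~ odd b).
  by apply: K_even => //; lia.
by apply: K_odd => //; lia.
Qed.
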